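(* Up to isomorphism of LCK Lie algebras, the four-dimensional unimodular integrable LCK Lie algebras are exactly the following, and they are pairwise non-isomorphic. In each case $U,V,X,Y$ is an orthonormal basis with $JU=V$, $JX=Y$, the Lee form is $\theta=g(U,\cdot)$, and brackets of basis vectors not listed (and not implied by antisymmetry) vanish: (a) for each $b\in\mathbb{R}$, the Lie algebra $\mathfrak{g}_b$ with $$[U,V]=V,\qquad [U,X]=-\tfrac12X+bY,\qquad [U,Y]=-bX-\tfrac12Y;$$ (b) the Lie algebra $\mathfrak{d}_4$ with $$[U,V]=V,\qquad [U,Y]=-Y,\qquad [V,Y]=X.$$
   Context: Lie algebras are real and finite-dimensional; for $\alpha\in\mathfrak{g}^*$ the Chevalley-Eilenberg differential satisfies $d\alpha(X,Y)=-\alpha([X,Y])$, and for a $2$-form $\Omega$, $d\Omega(X,Y,Z)=-\Omega([X,Y],Z)-\Omega([Y,Z],X)-\Omega([Z,X],Y)$. An LCK structure on a Lie algebra $\mathfrak{g}$ of even dimension at least $4$ consists of a positive definite inner product $g$, an endomorphism $J$ with $J^2=-\mathrm{Id}$ and $N_J(X,Y)=[JX,JY]-[X,Y]-J[JX,Y]-J[X,JY]=0$ for all $X,Y$, such that $\Omega(X,Y)=g(X,JY)$ is a $2$-form, and $1$-forms $\theta,\eta\in\mathfrak g^*$ with $d\Omega=\theta\wedge\Omega$, $d\theta=0$, and $\eta(X)=-\theta(JX)$. By rescaling the metric it is always assumed that $|\theta|=1$. The LCK Lie algebra is integrable if $\eta\wedge d\eta=0$. A Lie algebra is unimodular if $\mathrm{tr}(\mathrm{ad}_X)=0$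 for all $X$. An isomorphism of LCK Lie algebras is a Lie algebra isomorphism preserving $g$ and $J$. *)

(* Defs.v *)
From HB Require Import structures.
From mathcomp Require Import all_boot all_order all_algebra.
From mathcomp Require Import boolp classical_sets reals.
From mathcomp Require Import ring.

Set Implicit Arguments.
Unset Strict Implicit.
Unset Printing Implicit Defensive.

Import Order.TTheory GRing.Theory Num.Theory.

Local Open Scope ring_scope.

(* The data of a Lie algebra with a Hermitian structure and a 1-form; the      *)
(* axioms these data must satisfy are collected in [is_lck] below.             *)
Record lck_data (R : realType) := LCKData {
  carrier :> vectType R;
  brk : {bilinear carrier -> carrier -> carrier};
  met : {dot carrier for (@idfun R)};
  cplx : {linear carrier -> carrier};
  lee : {scalar carrier}
}.

Arguments brk {R} _.
Arguments met {R} _.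
Arguments cplx {R} _.
Arguments lee {R} _.

Section LCK.
Variables (R : realType) (L : lck_data R).
Implicit Types (x y z : L) (alpha : L -> R) (beta : L -> L -> R).

Local Notation "[[ x , y ]]" := (brk L x y) (at level 0, format "[[ x ,  y ]]").
Local Notation g := (met L).
Local Notation J := (cplx L).

Definition alternating (W : zmodType) (f : L -> L -> W) :=
  forall x, f x x = 0.

Definition is_lie_algebra : Prop :=
  alternating (brk L) /\
  forall x y z, [[x, [[y, z]]]] + [[y, [[z, x]]]] + [[z, [[x, y]]]] = 0.

(* Chevalley-Eilenberg differential on 1-forms and on 2-forms. *)
Definition ce1 alpha : L -> L -> R := fun x y => - alpha [[x, y]].

Definition ce2 beta : L -> L -> L -> R := fun x y z =>
  - beta [[x, y]] z - beta [[y, z]] x - beta [[z, x]] y.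

(* Wedge product of a 1-form with a 2-form, with the normalization for which   *)
(* (alpha /\ beta)(x, y) = alpha x * beta y - alpha y * beta x on 1-forms, the *)
(* one compatible with [ce1] and [ce2].                                        *)
Definition wedge12 alpha beta : L -> L -> L -> R := fun x y z =>
  alpha x * beta y z - alpha y * beta x z + alpha z * beta x y.

Definition fundamental_form : L -> L -> R := fun x y => g x (J y).

Definition eta_form : L -> R := fun x => - lee L (J x).

Definition nijenhuis x y : L :=
  [[J x, J y]] - [[x, y]] - J [[J x, y]] - J [[x, J y]].

(* The metric dual of a 1-form, and the norm it induces on the dual space. *)
Definition sharp alpha : L := xget 0 [set u | forall x, g u x = alpha x]%classic.

Definition conorm alpha : R := Num.sqrt (g (sharp alpha) (sharp alpha)).

Record is_lck : Prop := IsLCK {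
  lck_lie : is_lie_algebra;
  lck_even : ~~ odd (\dim {:L});
  lck_dim : (4 <= \dim {:L})%N;
  lck_cplx : forall x, J (J x) = - x;
  lck_nijenhuis : forall x y, nijenhuis x y = 0;
  lck_omega : alternating fundamental_form;
  lck_domega : forall x y z,
    ce2 fundamental_form x y z = wedge12 (lee L) fundamental_form x y z;
  lck_dlee : forall x y, ce1 (lee L) x y = 0;
  lck_unit : conorm (lee L) = 1
}.

Definition integrable : Prop :=
  forall x y z, wedge12 eta_form (ce1 eta_form) x y z = 0.

Definition ad x : 'End(L) := linfun (brk L x).

Definition lf_trace (f : 'End(L)) : R :=
  \tr (passmx.mxof (vbasis {:L}) (vbasis {:L}) f).

Definition unimodular : Prop := forall x, lf_trace (ad x) = 0.

End LCK.

Definition is_uilck4 (R : realType) (L : lck_data R) : Prop :=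
  [/\ is_lck L, \dim {:L} = 4%N, unimodular L & integrable L].

(* The Lee form is determined by the metric, the complex structure and the     *)
(* bracket, hence an isomorphism is not required to preserve it.               *)
Definition lck_iso (R : realType) (L1 L2 : lck_data R) : Prop :=
  exists f : {linear L1 -> L2}, [/\ bijective f,
    forall x y, f (brk L1 x y) = brk L2 (f x) (f y),
    forall x y, met L2 (f x) (f y) = met L1 x y &
    forall x, f (cplx L1 x) = cplx L2 (f x)].

Section Models.
Variable R : realType.
Local Notation E := 'rV[R]_4.
Implicit Types (x y : E) (c : nat -> nat -> E).

Definition eU : E := 'e_0.
Definition eV : E := 'e_1.
Definition eX : E := 'e_2.
Definition eY : E := 'e_3.

(* The alternating bilinear operation whose value on the i-th and j-th basis   *)
(* vectors is c i j for i < j; the other values of c are irrelevant.           *)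
Definition table_brk c x y : E :=
  \sum_(i < 4) \sum_(j < 4 | (i < j)%N)
    (x 0 i * y 0 j - x 0 j * y 0 i) *: c i j.

Lemma table_brk_bilinear c : bilinear_for
  (GRing.Scale.Law.clone _ _ *:%R _) (GRing.Scale.Law.clone _ _ *:%R _)
  (table_brk c).
Proof.
split=> [u|u] a x y /=; rewrite /table_brk scaler_sumr -big_split /=;
  apply: eq_bigr => i _; rewrite scaler_sumr -big_split /=;
  apply: eq_bigr => j _; rewrite !mxE scalerA -scalerDl; congr (_ *: _); ring.
Qed.

HB.instance Definition _ c :=
  bilinear_isBilinear.Build R E E E _ _ (table_brk c) (table_brk_bilinear c).

Lemma table_brkE c (i j : 'I_4) : (i < j)%N -> table_brk c 'e_i 'e_j = c i j.
Proof.
move=> ij; rewrite /table_brk (bigD1 i) //= (bigD1 j) //=.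
rewrite [X in _ + X + _]big1 => [|k /andP[ik kj]]; last first.
  rewrite !mxE !eqxx /= (negPf kj) -[k == i]val_eqE /= gtn_eqF //.
  by rewrite mulr0 mul0r subr0 scale0r.
rewrite [X in _ + X]big1 => [|k ki]; last first.
  apply: big1 => l kl; rewrite !mxE !eqxx /= (negPf ki) mul0r sub0r.
  case: (l =P i) kl => [->|_] kl; last by rewrite mul0r oppr0 scale0r.
  case: (k =P j) kl => [->|_] kl; last by rewrite mulr0 oppr0 scale0r.
  by move: (ltn_trans ij kl); rewrite ltnn.
rewrite !mxE !eqxx /= -[i == j]val_eqE -[j == i]val_eqE /= gtn_eqF // ltn_eqF //.
by rewrite mulr1 mulr0 subr0 scale1r !addr0.
Qed.

(* The inner product for which eU, eV, eX, eY is orthonormal. *)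
Definition std_met x y : R := \sum_(i < 4) x 0 i * y 0 i.

Lemma std_met_bilinear : bilinear_for
  (GRing.Scale.Law.clone _ _ *%R _) (GRing.Scale.Law.clone _ _ *%R _) std_met.
Proof.
split=> [u|u] a x y /=; rewrite /std_met mulr_sumr -big_split /=;
  apply: eq_bigr => i _; rewrite !mxE.
  by rewrite mulrDl mulrA.
by rewrite mulrDr mulrCA.
Qed.

HB.instance Definition _ :=
  bilinear_isBilinear.Build R E E R _ _ std_met std_met_bilinear.

HB.instance Definition _ x :=
  GRing.isLinear.Build R E R *%R (std_met x) (std_met_bilinear.2 x).

Lemma std_met_herm x y : std_met x y = (-1) ^+ false * idfun (std_met y x).
Proof. by rewrite mul1r; apply: eq_bigr => i _; rewrite mulrC. Qed.

HB.instance Definition _ :=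
  isHermitianSesquilinear.Build R E false idfun std_met std_met_herm.

Lemma std_met_gt0 x : x != 0 -> 0 < std_met x x.
Proof.
move=> x0; rewrite lt_def sumr_ge0 ?andbT => [|i _]; last by rewrite -expr2 sqr_ge0.
apply: contra x0 => /eqP s0; apply/eqP/rowP => i; rewrite mxE.
have /psumr_eq0P : forall j : 'I_4, true -> 0 <= x 0 j * x 0 j.
  by move=> j _; rewrite -expr2 sqr_ge0.
by move=> /(_ s0 i isT)/eqP; rewrite -expr2 sqrf_eq0 => /eqP.
Qed.

HB.instance Definition _ := isDotProduct.Build R E std_met std_met_gt0.

(* Row vectors are acted upon from the right: eU |-> eV |-> - eU and           *)
(* eX |-> eY |-> - eX.                                                         *)
Definition Jmx : 'M[R]_4 :=
  delta_mx 0 1 - delta_mx 1 0 + delta_mx 2 3 - delta_mx 3 2.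

Definition model c : lck_data R :=
  @LCKData R E (table_brk c) std_met (mulmxr Jmx) (std_met eU).

Definition table_gb (b : R) : nat -> nat -> E := fun i j =>
  match i, j with
  | 0%N, 1%N => eV
  | 0%N, 2%N => - (1 / 2) *: eX + b *: eY
  | 0%N, 3%N => - b *: eX - (1 / 2) *: eY
  | _, _ => 0
  end.

Definition table_d4 : nat -> nat -> E := fun i j =>
  match i, j with
  | 0%N, 1%N => eV
  | 0%N, 3%N => - eY
  | 1%N, 3%N => eX
  | _, _ => 0
  end.

Definition lck_gb (b : R) : lck_data R := model (table_gb b).

Definition lck_d4 : lck_data R := model table_d4.

End Models.

Arguments eU {R}.
Arguments eV {R}.
Arguments eX {R}.
Arguments eY {R}.
Arguments lck_d4 {R}.

(* Main.v *)
Require Import Defs.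
From mathcomp Require Import all_boot all_order all_algebra.
From mathcomp Require Import boolp classical_sets reals.
From mathcomp Require Import ring lra.
From HB Require Import structures.

Set Implicit Arguments.
Unset Strict Implicit.
Unset Printing Implicit Defensive.

Import Order.TTheory GRing.Theory Num.Theory.

Local Open Scope ring_scope.

(** Let U be the metric dual of the Lee form and V = J U, and call a unit vector
X orthogonal to U and V adapted, so that U, V, X, J X is a unitary frame.  The
whole argument takes place in such a frame.

The equations that define an integrable unimodular structure, apart from the
Jacobi identity, are linear in the structure constants.  Evaluated on the frame
they leave [U, V] = V, [X, J X] = 0 and two endomorphisms A = ad U and B = ad V
of the plane spanned by X and J X, with tr A = -1, tr B = 0 and
[B, J] = A + J A J, the last relation coming from the Nijenhuis tensor
([adapted_brk]).  The Jacobi identity then says exactly [A, B] = B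
([adapted_jacobi]).  Hence tr (B^2) = tr (B [A, B]) = 0, and a traceless
endomorphism of a plane with tr (B^2) = 0 has square zero ([brk_nilpotent]).  So
B kills some adapted vector, and X may be taken to be that vector
([exists_adapted_ker]).  With B X = 0 the remaining relations force
B (J X) = t X with t^2 = t.  If t = 0, then A is -1/2 plus a rotation generator,
which is the table of g_b; if t = 1, then A (J X) = - J X and A X = 0, which is
the table of d_4.

A unitary frame with the structure constants of a model gives an isomorphism
onto that model by taking coordinates ([frame_lck_iso]).

For the converse separation, Omega is nondegenerate and the dimension is at
least 4, so the Lee form is determined by d Omega and is preserved by any
isomorphism ([lck_iso_lee]); an isomorphism of models therefore fixes the first
two coordinates.  The number b is then read off from g([U, X], J X)
([gb_twist]), and g_b differs from d_4 because V commutes with the plane of X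
and J X in the former only. *)

(** * Inner product, complex structure and frames *)

Section Hermitian.
Variables (R : realType) (L : lck_data R).
Local Notation g := (met L).
Local Notation J := (cplx L).
Implicit Types x y z : L.

Lemma metC x y : g x y = g y x.
Proof. by rewrite hermC /= mul1r. Qed.

Lemma met_gt0 x : (0 < g x x) = (x != 0).
Proof.
apply/idP/idP => [|/neq0_dnorm_gt0//].
by apply: contraTneq => ->; rewrite linear0r ltxx.
Qed.

Lemma metDl x y z : g (x + y) z = g x z + g y z.
Proof. by rewrite linearDl. Qed.
Lemma metZl a x z : g (a *: x) z = a * g x z.
Proof. by rewrite linearZl_LR. Qed.
Lemma metZr a x z : g x (a *: z) = a * g x z.
Proof. by rewrite metC metZl metC. Qed.
Lemma metDr x y z : g x (y + z) = g x y + g x z.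
Proof. by rewrite linearDr. Qed.
Lemma metNr x y : g x (- y) = - g x y.
Proof. by rewrite linearNr. Qed.

Lemma brkDl x y z : brk L (x + y) z = brk L x z + brk L y z.
Proof. by rewrite linearDl. Qed.
Lemma brkDr x y z : brk L x (y + z) = brk L x y + brk L x z.
Proof. by rewrite linearDr. Qed.
Lemma brkNr x y : brk L x (- y) = - brk L x y.
Proof. by rewrite linearNr. Qed.
Lemma brkZr a x z : brk L x (a *: z) = a *: brk L x z.
Proof. by rewrite linearZr_LR. Qed.

Lemma brkC x y : alternating (brk L) -> brk L x y = - brk L y x.
Proof.
move=> lie; have := lie (x + y); rewrite brkDl !brkDr !lie add0r addr0.
by move/eqP; rewrite addr_eq0 => /eqP.
Qed.

(** Two linear equations cut out a subspace of codimension at most 2. *)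
Lemma exists_orthogonal x y : (2 < \dim {:L})%N ->
  exists2 z, z != 0 & g x z = 0 /\ g y z = 0.
Proof.
move=> dL.
pose W := (fullv :&: orthov g <[x]> :&: orthov g <[y]>)%VS.
have W0 : (0 < \dim W)%N.
  have h1 := leq_dim_orthov1 g x fullv.
  have h2 := leq_dim_orthov1 g y (fullv :&: orthov g <[x]>)%VS.
  apply: leq_trans h2; rewrite -ltnS; apply: (leq_trans _ (leqSpred _)).
  by apply: leq_trans h1; rewrite -ltnS; apply: (leq_trans _ (leqSpred _)).
exists (vpick W); first by rewrite vpick0 -dimv_eq0 -lt0n.
have := memv_pick W; rewrite !memv_cap => /andP[/andP[_]].
by rewrite !mem_orthov1 metC => /eqP-> ; rewrite metC => /eqP->.
Qed.

Section ComplexStructure.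
Hypothesis J2 : forall x, J (J x) = - x.
Hypothesis OmA : alternating (fundamental_form (L := L)).

(** Polarization of g (x, J x) = 0. *)
Lemma met_cplx x y : g (J x) y = - g x (J y).
Proof.
have := OmA (x + y); rewrite /fundamental_form linearD /= metDl !linearDr /=.
have := OmA x; have := OmA y; rewrite /fundamental_form => -> ->.
by rewrite add0r addr0 [g y _]metC => /eqP; rewrite addrC addr_eq0 => /eqP.
Qed.

Lemma met_cplx2 x y : g (J x) (J y) = g x y.
Proof. by rewrite met_cplx J2 linearNr /= opprK. Qed.

End ComplexStructure.

Section Frame.
Variables (n : nat) (e : 'I_n -> L).
Hypothesis e_on : forall i j, g (e i) (e j) = (i == j)%:R.

(** An orthonormal family is free, hence a basis when its size is the dimension;
its coordinates are the inner products. *)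
Lemma orthonormal_expand : \dim {:L} = n -> forall x, x = \sum_i g (e i) x *: e i.
Proof.
move=> dL.
pose E := [tuple e i | i < n].
have En (i : 'I_n) : E`_i = e i by rewrite -tnth_nth tnth_mktuple.
have coef (k : 'I_n -> R) j : g (e j) (\sum_i k i *: E`_i) = k j.
  rewrite linear_sum /= (bigD1 j) //= big1 ?addr0 => [|i ij].
    by rewrite En metZr e_on eqxx mulr1.
  by rewrite En metZr e_on eq_sym (negPf ij) mulr0.
have fE : free E.
  by apply/freeP => k k0 i; rewrite -(coef k i) k0 linear0r.
have bE : basis_of fullv E by rewrite basisEfree fE subvf dL size_tuple /=.
move=> x; rewrite [LHS](coord_basis bE (memvf x)).
by apply: eq_bigr => i _; rewrite [in RHS](coord_basis bE (memvf x)) coef En.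
Qed.

End Frame.

(** The trace does not depend on the basis: expanding each vector of [vbasis] on
the family e, and each f (e i) on [vbasis], gives the same double sum. *)
Lemma trace_expand n (e : 'I_n -> L) (f : 'End(L)) :
    (forall x, x = \sum_i g (e i) x *: e i) ->
  lf_trace f = \sum_i g (e i) (f (e i)).
Proof.
move=> exp; rewrite /lf_trace /mxtrace.
have vb := vbasisP {:L}.
transitivity (\sum_(k < \dim {:L}) \sum_i g (e i) (vbasis {:L})`_k *
     coord (vbasis {:L}) k (f (e i))).
  apply: eq_bigr => k _; rewrite !mxE /=.
  rewrite -(passmx.rVofE vb) passmx.rVofK //.
  rewrite {1}[_`_k in LHS]exp !linear_sum.
  by apply: eq_bigr => i _; rewrite !linearZ.
rewrite exchange_big; apply: eq_bigr => i _.
rewrite [f (e i) in RHS](coord_basis vb (memvf _)) linear_sum.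
by apply: eq_bigr => k _; rewrite /= metZr mulrC.
Qed.

End Hermitian.

Lemma ord4_ind (P : 'I_4 -> Prop) : P 0 -> P 1 -> P 2 -> P 3 -> forall i, P i.
Proof.
move=> P0 P1 P2 P3 [[|[|[|[|//]]]] lti].
- by rewrite (_ : Ordinal lti = 0) //; apply: val_inj.
- by rewrite (_ : Ordinal lti = 1) //; apply: val_inj.
- by rewrite (_ : Ordinal lti = 2) //; apply: val_inj.
- by rewrite (_ : Ordinal lti = 3) //; apply: val_inj.
Qed.

Lemma big_ord4 (V : nmodType) (F : 'I_4 -> V) :
  \sum_i F i = F 0 + F 1 + F 2 + F 3.
Proof.
rewrite !big_ord_recr /= big_ord0 add0r.
by congr (F _ + F _ + F _ + F _); apply: val_inj.
Qed.

(** * The Lee form *)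

Section LeeForm.
Variables (R : realType).

(** In dimension at least 4, wedging with Omega is injective on 1-forms: for y
orthogonal to x and J x, the value of b /\ Omega on (x, y, J y) is
- b (x) g (y, y). *)
Lemma wedge_fundamental_inj (L : lck_data R) (b : {scalar L}) : is_lck L ->
  (forall x y z, wedge12 b (fundamental_form (L := L)) x y z = 0) ->
  forall x, b x = 0.
Proof.
move=> lckL b0 x.
have J2 := lck_cplx lckL; have OmA := lck_omega lckL.
have [|y y0 [xy Jxy]] := exists_orthogonal x (cplx L x).
  exact: leq_trans (lck_dim lckL).
have := b0 x y (cplx L y); rewrite /wedge12 /fundamental_form J2 !linearNr /= xy.
rewrite -(opprK (met L x (cplx L y))) -met_cplx // Jxy !oppr0 !mulr0 subr0 addr0.
move/eqP; rewrite mulrN oppr_eq0 mulf_eq0 [met _ _ _ == 0]gt_eqF ?met_gt0 //.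
by rewrite orbF => /eqP.
Qed.

(** Both Lee forms, pulled back to the source, have the same wedge product with
Omega, namely d Omega. *)
Lemma lck_iso_lee (L1 L2 : lck_data R) (f : {linear L1 -> L2}) :
    is_lck L1 -> is_lck L2 ->
    (forall x y, f (brk L1 x y) = brk L2 (f x) (f y)) ->
    (forall x y, met L2 (f x) (f y) = met L1 x y) ->
    (forall x, f (cplx L1 x) = cplx L2 (f x)) ->
  forall x, lee L2 (f x) = lee L1 x.
Proof.
move=> lck1 lck2 fbrk fmet fJ x; apply/eqP; rewrite -subr_eq0; apply/eqP.
pose b : {scalar L1} := (lee L2 \o f) \- lee L1.
apply: (wedge_fundamental_inj (b := b)) => // {}x y z.
have := lck_domega lck2 (f x) (f y) (f z).
rewrite /ce2 /wedge12 /fundamental_form -!fJ -!fbrk !fmet => h2.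
have := lck_domega lck1 x y z.
rewrite /ce2 /wedge12 /fundamental_form h2 => h1.
rewrite /wedge12 /= !mulrBl; lra.
Qed.

(** If no vector represented the Lee form, [sharp] would take its default value 0
and the norm could not be 1; hence the norm condition alone provides the dual
vector. *)
Lemma sharp_unit (L : lck_data R) : is_lck L ->
  met L (sharp (lee L)) (sharp (lee L)) = 1 /\
  forall x, met L (sharp (lee L)) x = lee L x.
Proof.
move=> lckL; have := lck_unit lckL; rewrite /conorm => s1.
have n1 : met L (sharp (lee L)) (sharp (lee L)) = 1.
  rewrite -[LHS]sqr_sqrtr ?s1 ?expr1n //.
  have [->|] := eqVneq (sharp (lee L)) 0; first by rewrite linear0r.
  by rewrite -met_gt0 => /ltW.
split=> // x; move: n1; rewrite /sharp; case: xgetP => [u _ uE _|_].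
  exact: uE.
by rewrite linear0r => /eqP; rewrite eq_sym oner_eq0.
Qed.

End LeeForm.

(** * The models *)

(* Simplification must not replace the structure of a model by its raw
   formulas, on which the coordinate lemmas below would no longer rewrite. *)
Arguments brk : simpl never.
Arguments met : simpl never.
Arguments cplx : simpl never.
Arguments lee : simpl never.

Section ModelCoordinates.
Variables (R : realType) (c : nat -> nat -> 'rV[R]_4).
Implicit Types x y : model c.

Lemma model_cplxE x i :
  (cplx (model c) x : 'rV[R]_4) 0 i = [:: - x 0 1; x 0 0; - x 0 3; x 0 2]`_i.
Proof.
by elim/ord4_ind: i; rewrite mxE big_ord4 !mxE /=; ring.
Qed.

Lemma model_metE x y :
  met (model c) x y = x 0 0 * y 0 0 + x 0 1 * y 0 1 + x 0 2 * y 0 2 + x 0 3 * y 0 3.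
Proof. exact: big_ord4. Qed.

Lemma model_leeE x : lee (model c) x = x 0 0.
Proof.
by rewrite [LHS]big_ord4 !mxE /=; ring.
Qed.

Lemma model_brkE x y k : (brk (model c) x y : 'rV[R]_4) 0 k =
  (x 0 0 * y 0 1 - x 0 1 * y 0 0) * c 0%N 1%N 0 k +
  (x 0 0 * y 0 2 - x 0 2 * y 0 0) * c 0%N 2%N 0 k +
  (x 0 0 * y 0 3 - x 0 3 * y 0 0) * c 0%N 3%N 0 k +
  (x 0 1 * y 0 2 - x 0 2 * y 0 1) * c 1%N 2%N 0 k +
  (x 0 1 * y 0 3 - x 0 3 * y 0 1) * c 1%N 3%N 0 k +
  (x 0 2 * y 0 3 - x 0 3 * y 0 2) * c 2%N 3%N 0 k.
Proof.
rewrite [brk _ x y](_ : _ = table_brk c x y) // /table_brk.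
under eq_bigr => i _ do rewrite big_mkcond big_ord4.
rewrite big_ord4 /= ?addr0 ?add0r !mxE.
by rewrite !addrA.
Qed.

Lemma table_brk_alternating : alternating (brk (model c)).
Proof.
move=> x; apply: big1 => i _; apply: big1 => j _.
by rewrite mulrC subrr scale0r.
Qed.

Lemma model_trace x : lf_trace (ad x) =
  \sum_i (brk (model c) x ('e_i : 'rV[R]_4) : 'rV[R]_4) 0 i.
Proof.
have metE i y : met (model c) ('e_i : 'rV[R]_4) y = y 0 i.
  rewrite model_metE !mxE /=.
  by elim/ord4_ind: i => /=; ring.
rewrite (@trace_expand _ (model c) 4 (fun i => 'e_i : 'rV[R]_4)) => [|y].
  by apply: eq_bigr => i _; rewrite metE lfunE.
rewrite [LHS]row_sum_delta; apply: eq_bigr => i _.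
by congr (_ *: _).
Qed.

Lemma model_eq x y : (forall i, (x : 'rV[R]_4) 0 i = y 0 i) -> x = y.
Proof. by move=> xy; exact/rowP. Qed.

Lemma model_addE x y i : (x + y : 'rV[R]_4) 0 i = x 0 i + y 0 i.
Proof. exact: mxE. Qed.
Lemma model_oppE x i : (- x : 'rV[R]_4) 0 i = - x 0 i.
Proof. exact: mxE. Qed.
Lemma model_zeroE i : ((0 : model c) : 'rV[R]_4) 0 i = 0.
Proof. exact: mxE. Qed.
Definition model_zmodE := (model_addE, model_oppE, model_zeroE).

(** The axioms which involve only the metric and J hold for any table; four
conditions on the brackets remain. *)
Lemma model_lck :
    (forall x y z, brk (model c) x (brk (model c) y z) +
       brk (model c) y (brk (model c) z x) +
       brk (model c) z (brk (model c) x y) = 0) ->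
    (forall x y, nijenhuis x y = 0) ->
    (forall x y z, ce2 (fundamental_form (L := model c)) x y z =
       wedge12 (lee (model c)) (fundamental_form (L := model c)) x y z) ->
    (forall x y, (brk (model c) x y : 'rV[R]_4) 0 0 = 0) ->
  is_lck (model c).
Proof.
have dim4 : \dim {:model c} = 4%N by rewrite dimvf dim_matrix.
move=> jac nij dom dlee; split=> //.
- by split=> //; exact: table_brk_alternating.
- by rewrite dim4.
- by rewrite dim4.
- move=> x; apply: model_eq.
  by elim/ord4_ind; rewrite model_oppE !model_cplxE //= ?model_cplxE.
- by move=> x; rewrite /fundamental_form model_metE !model_cplxE /=; ring.
- by move=> x y; rewrite /ce1 model_leeE dlee oppr0.
- rewrite /conorm /sharp; case: xgetP => [u _ uE|/(_ eU)[]//].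
  rewrite uE -[lee _ u]/(met (model c) eU u) metC uE.
  by rewrite model_leeE mxE sqrtr1.
Qed.

End ModelCoordinates.

Section Models.
Variable R : realType.
Implicit Types b : R.

Lemma gb_brkE b (x y : model (table_gb b)) i :
  (brk (model (table_gb b)) x y : 'rV[R]_4) 0 i =
  [:: 0; x 0 0 * y 0 1 - x 0 1 * y 0 0;
      - (1 / 2) * (x 0 0 * y 0 2 - x 0 2 * y 0 0)
        - b * (x 0 0 * y 0 3 - x 0 3 * y 0 0);
      b * (x 0 0 * y 0 2 - x 0 2 * y 0 0)
        - (1 / 2) * (x 0 0 * y 0 3 - x 0 3 * y 0 0)]`_i.
Proof. by rewrite model_brkE !mxE; elim/ord4_ind: i => /=; ring. Qed.

Lemma d4_brkE (x y : model (@table_d4 R)) i :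
  (brk (model (@table_d4 R)) x y : 'rV[R]_4) 0 i =
  [:: 0; x 0 0 * y 0 1 - x 0 1 * y 0 0;
      x 0 1 * y 0 3 - x 0 3 * y 0 1;
      - (x 0 0 * y 0 3 - x 0 3 * y 0 0)]`_i.
Proof. by rewrite model_brkE !mxE; elim/ord4_ind: i => /=; ring. Qed.

Lemma gb_uilck4 b : is_uilck4 (lck_gb b).
Proof.
rewrite /lck_gb; split; last 3 first.
- by rewrite dimvf dim_matrix.
- by move=> x; rewrite model_trace big_ord4 !gb_brkE !mxE /=; by field.
- move=> x y z; rewrite /wedge12 /ce1 /eta_form !model_leeE.
  by rewrite !model_cplxE /= ?gb_brkE /=; by field.
apply: model_lck => [x y z|x y|x y z|x y].
- apply: model_eq; elim/ord4_ind; rewrite !model_zmodE !gb_brkE /= ?gb_brkE /=; by field.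
- rewrite /nijenhuis; apply: model_eq; elim/ord4_ind;
    rewrite !model_zmodE !model_cplxE /= ?model_oppE !gb_brkE /=;
    rewrite ?model_cplxE /=; by field.
- rewrite /ce2 /wedge12 /fundamental_form !model_leeE !model_metE !model_cplxE /=.
  by rewrite !gb_brkE /=; by field.
- by rewrite gb_brkE.
Qed.

Lemma d4_uilck4 : is_uilck4 (@lck_d4 R).
Proof.
rewrite /lck_d4; split; last 3 first.
- by rewrite dimvf dim_matrix.
- by move=> x; rewrite model_trace big_ord4 !d4_brkE !mxE /=; ring.
- move=> x y z; rewrite /wedge12 /ce1 /eta_form !model_leeE.
  by rewrite !model_cplxE /= ?d4_brkE /=; ring.
apply: model_lck => [x y z|x y|x y z|x y].
- apply: model_eq; elim/ord4_ind; rewrite !model_zmodE !d4_brkE /= ?d4_brkE /=; ring.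
- rewrite /nijenhuis; apply: model_eq; elim/ord4_ind;
    rewrite !model_zmodE !model_cplxE /= ?model_oppE !d4_brkE /=;
    rewrite ?model_cplxE /=; ring.
- rewrite /ce2 /wedge12 /fundamental_form !model_leeE !model_metE !model_cplxE /=.
  by rewrite !d4_brkE /=; ring.
- by rewrite d4_brkE.
Qed.

End Models.

(** * Isomorphisms obtained from frames *)

Section FrameIso.
Variables (R : realType) (L : lck_data R) (e : 'I_4 -> L).
Hypothesis e_on : forall i j, met L (e i) (e j) = (i == j)%:R.

Definition frame_coord (x : L) : 'rV[R]_4 := \row_i met L (e i) x.

Lemma frame_coord_linear : linear frame_coord.
Proof.
by move=> a x y; apply/rowP => i; rewrite !mxE linearD /= metZr.
Qed.

HB.instance Definition _ :=
  GRing.isLinear.Build R L 'rV[R]_4 _ frame_coord frame_coord_linear.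

Hypothesis dim4 : \dim {:L} = 4%N.
Hypothesis lie : alternating (brk L).
Variable c : nat -> nat -> 'rV[R]_4.
Hypothesis J2 : forall x, cplx L (cplx L x) = - x.
Hypothesis J01 : cplx L (e 0) = e 1.
Hypothesis J23 : cplx L (e 2) = e 3.
Hypothesis brkE : forall i j : 'I_4, (i < j)%N ->
  brk L (e i) (e j) = \sum_k c i j 0 k *: e k.

Let coordE i : frame_coord (e i) = 'e_i.
Proof. by apply/rowP => j; rewrite !mxE e_on eqxx eq_sym. Qed.

Let expand x : x = \sum_i frame_coord x 0 i *: e i.
Proof.
rewrite [LHS](orthonormal_expand e_on dim4).
by apply: eq_bigr => i _; rewrite mxE.
Qed.

Let coord_comb (v : 'rV[R]_4) : frame_coord (\sum_i v 0 i *: e i) = v.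
Proof.
rewrite linear_sum [RHS]row_sum_delta; apply: eq_bigr => i _ /=.
by rewrite linearZ /= coordE.
Qed.

(** Both brackets are alternating and bilinear, so it is enough to compare them
on pairs (e i, e j) with i < j. *)
Lemma frame_lck_iso : lck_iso L (model c).
Proof.
exists (frame_coord : {linear _ -> _}); split=> /=.
- exists (fun v : 'rV[R]_4 => \sum_i v 0 i *: e i) => [x|v]; last exact: coord_comb.
  exact: (esym (expand x)).
- have lt (i j : 'I_4) : (i < j)%N ->
      frame_coord (brk L (e i) (e j)) = table_brk c 'e_i 'e_j.
    by move=> ij; rewrite brkE // coord_comb table_brkE.
  have lie_model := @table_brk_alternating R c.
  move=> x y; rewrite {1}[x]expand {1}[y]expand.
  rewrite [in RHS](row_sum_delta (frame_coord x)).
  rewrite [in RHS](row_sum_delta (frame_coord y)).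
  rewrite !linear_sumlz !linear_sum; apply: eq_bigr => i _.
  rewrite !linear_sum; apply: eq_bigr => j _ /=.
  rewrite !linearZl_LR !linearZ /=; congr (_ *: (_ *: _)).
  have [/lt//|/lt ji|/ord_inj <-] := ltngtP i j.
    by rewrite brkC // linearN (brkC (L := model c)) //; congr (- _).
  by rewrite lie linear0; apply/esym/lie_model.
- move=> x y; rewrite [y in RHS]expand linear_sum; apply: eq_bigr => i _ /=.
  by rewrite metZr mulrC; congr (_ * _); rewrite mxE metC.
- move=> x; have J1 : cplx L (e 1) = - e 0 by rewrite -J01 J2.
  have J3 : cplx L (e 3) = - e 2 by rewrite -J23 J2.
  rewrite {1}[x]expand linear_sum {1}[frame_coord x in RHS]row_sum_delta mulmx_suml.
  rewrite linear_sum; apply: eq_bigr => i _; rewrite -scalemxAl /= !linearZ /=.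
  congr (_ *: _).
  apply/rowP => j; rewrite (model_cplxE (c := c)) !mxE.
  by elim/ord4_ind: i; rewrite ?J01 ?J1 ?J23 ?J3 ?linearNr /= e_on;
     elim/ord4_ind: j => /=; rewrite ?mxE //= ?mulr0n ?mulr1n ?oppr0.
Qed.

End FrameIso.

(** * The models are pairwise non-isomorphic *)

Section NonIsomorphism.
Variable R : realType.

(** In a model the coordinate along U is the Lee form, and the one along V is,
up to sign, the Lee form composed with J. *)
Lemma model_iso_coord (c c' : nat -> nat -> 'rV[R]_4)
    (f : {linear model c -> model c'}) :
    is_lck (model c) -> is_lck (model c') ->
    (forall x y, f (brk (model c) x y) = brk (model c') (f x) (f y)) ->
    (forall x y, met (model c') (f x) (f y) = met (model c) x y) ->
    (forall x, f (cplx (model c) x) = cplx (model c') (f x)) ->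
  forall x, ((f x : 'rV[R]_4) 0 0 = (x : 'rV[R]_4) 0 0) *
            ((f x : 'rV[R]_4) 0 1 = (x : 'rV[R]_4) 0 1).
Proof.
move=> lck1 lck2 fbrk fmet fJ x.
have lee0 y : (f y : 'rV[R]_4) 0 0 = (y : 'rV[R]_4) 0 0.
  by rewrite -model_leeE (lck_iso_lee lck1 lck2 fbrk fmet fJ) model_leeE.
split=> //; have := lee0 (cplx (model c) x).
by rewrite fJ !model_cplxE /= => /oppr_inj.
Qed.

(** The parameter b is the rotation speed of ad U on the plane orthogonal to U
and V, which is expressed here by the metric, J and the bracket only. *)
Lemma gb_twist (b : R) (x y : model (table_gb b)) :
    x 0 0 = 1 -> y 0 0 = 0 -> y 0 1 = 0 ->
  met _ (brk _ x y) (cplx _ y) = b * met _ y y.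
Proof.
move=> x0 y0 y1; rewrite !model_metE !gb_brkE !model_cplxE /= x0 y0 y1.
by field.
Qed.

Lemma lck_iso_gb_inj (b b' : R) : lck_iso (lck_gb b) (lck_gb b') -> b = b'.
Proof.
rewrite /lck_gb; case=> f [_ fbrk fmet fJ].
have [lck1 _ _ _] := gb_uilck4 b; have [lck2 _ _ _] := gb_uilck4 b'.
have fE := model_iso_coord lck1 lck2 fbrk fmet fJ.
pose u : model (table_gb b) := eU; pose x : model (table_gb b) := eX.
have := fmet (brk _ u x) (cplx _ x).
have XX : met _ x x = 1 by rewrite model_metE !mxE /=; ring.
rewrite fbrk fJ !gb_twist ?fE ?fmet ?mxE // XX !mulr1 => -> //.
Qed.

Lemma not_lck_iso_gb_d4 (b : R) : ~ lck_iso (lck_gb b) (@lck_d4 R).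
Proof.
rewrite /lck_gb /lck_d4; case=> f [_ fbrk fmet fJ].
have [lck1 _ _ _] := gb_uilck4 b; have [lck2 _ _ _] := d4_uilck4 R.
have fE := model_iso_coord lck1 lck2 fbrk fmet fJ.
pose v : model (table_gb b) := eV; pose x : model (table_gb b) := eX.
(* For z orthogonal to U and V, the bracket [V, z] vanishes in g_b, while the
   component of [f V, f z] along X in d_4 is the last coordinate of f z. *)
have V0 (z : model (table_gb b)) : z 0 0 = 0 -> z 0 1 = 0 -> (f z) 0 3 = 0.
  move=> z0 z1; have : brk _ v z = 0.
    apply: model_eq => i; rewrite gb_brkE model_zeroE z0.
    by elim/ord4_ind: i; rewrite !mxE /=; ring.
  move/(congr1 f); rewrite fbrk linear0 => fz.
  have := d4_brkE (f v) (f z) 2; rewrite fz model_zeroE /= !fE z1 !mxE /=.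
  lra.
(* Applied to X and J X, this makes both remaining coordinates of f X vanish. *)
have xE : (x 0 0 = 0) * (x 0 1 = 0) by rewrite !mxE.
have := V0 x xE.1 xE.2; have := V0 (cplx _ x).
rewrite !model_cplxE /= !xE oppr0 => /(_ erefl erefl).
rewrite fJ model_cplxE /= => x2 x3.
have := fmet x x; rewrite !model_metE x2 x3 !fE !mxE /=; lra.
Qed.

End NonIsomorphism.

(** * Classification *)

Section Classification.
Variables (R : realType) (L : lck_data R).
Hypothesis uiL : is_uilck4 L.
Local Notation g := (met L).
Local Notation J := (cplx L).
Local Notation "{[ x , y ]}" := (brk L x y) (at level 0, format "{[ x ,  y ]}").
Local Notation U := (sharp (lee L)).
Local Notation V := (J U).
Implicit Types x y z X : L.

Let lckL : is_lck L. Proof. by case: uiL. Qed.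
Let dim4 : \dim {:L} = 4%N. Proof. by case: uiL. Qed.
Let J2 := lck_cplx lckL.
Let brkA : alternating (brk L) := (lck_lie lckL).1.
Let UU : g U U = 1 := (sharp_unit lckL).1.
Let leeE x : lee L x = g U x. Proof. by rewrite (sharp_unit lckL).2. Qed.
Let met_cplx x y : g (J x) y = - g x (J y) := met_cplx (lck_omega lckL) x y.
Let OmA x : g x (J x) = 0 := lck_omega lckL x.

Definition adapted X := [/\ g X X = 1, g U X = 0 & g V X = 0].

Definition adapted_frame X (i : 'I_4) : L := [:: U; V; X; J X]`_i.

Lemma adapted_table X : adapted X ->
  (g U U = 1) * (g U V = 0) * (g U X = 0) * (g U (J X) = 0) *
  (g V U = 0) * (g V V = 1) * (g V X = 0) * (g V (J X) = 0) *
  (g X U = 0) * (g X V = 0) * (g X X = 1) * (g X (J X) = 0) *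
  (g (J X) U = 0) * (g (J X) V = 0) * (g (J X) X = 0) * (g (J X) (J X) = 1).
Proof.
case=> XX UX VX; have UJX : g U (J X) = 0 by rewrite -[LHS]opprK -met_cplx VX oppr0.
have VJX : g V (J X) = 0 by rewrite met_cplx J2 linearNr /= UX !oppr0.
have JXJX : g (J X) (J X) = 1 by rewrite met_cplx2 ?XX //; exact: lck_omega.
have VV : g V V = 1 by rewrite met_cplx2 ?UU //; exact: lck_omega.
have UV := OmA U; have XJX := OmA X.
do !split=> //; by rewrite metC.
Qed.

Lemma adapted_frame_on X : adapted X ->
  forall i j, g (adapted_frame X i) (adapted_frame X j) = (i == j)%:R.
Proof.
move=> /adapted_table aX i j.
by elim/ord4_ind: i; elim/ord4_ind: j; rewrite /adapted_frame /= aX.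
Qed.

Lemma adapted_expand X : adapted X -> forall x,
  x = g U x *: U + g V x *: V + g X x *: X + g (J X) x *: J X.
Proof.
move=> aX x; rewrite [LHS](orthonormal_expand (adapted_frame_on aX) dim4).
by rewrite big_ord4.
Qed.

Lemma unimodular_expand X : adapted X -> forall x,
  g U {[x, U]} + g V {[x, V]} + g X {[x, X]} + g (J X) {[x, J X]} = 0.
Proof.
move=> aX x; have [_ _ /(_ x) uni _] := uiL.
rewrite -[RHS]uni (trace_expand _ (orthonormal_expand (adapted_frame_on aX) dim4)).
by rewrite big_ord4 !lfunE.
Qed.

(** The Lee form is closed, so it vanishes on brackets. *)
Lemma lee_brk x y : g U {[x, y]} = 0.
Proof. by apply: oppr_inj; rewrite -leeE oppr0; exact: lck_dlee. Qed.

(** The form eta is g (V, .), and contracting eta /\ d eta with V leaves d eta on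
the kernel of eta. *)
Lemma integrableE x y : g V x = 0 -> g V y = 0 -> g V {[x, y]} = 0.
Proof.
have [_ _ _ /(_ V x y)] := uiL; rewrite /wedge12 /ce1 /eta_form !leeE J2.
rewrite -!met_cplx linearNr /= UU opprK => h Vx Vy; move: h.
rewrite Vx Vy; lra.
Qed.

(** The closedness of the Lee form and integrability remove the components of the
brackets along U and some of those along V; the remaining relations are the
traces of ad U, ad X, ad Y, the equation for d Omega on the triples of frame
vectors, and the four components of the Nijenhuis tensor on (U, X).  Written
with A = ad U and B = ad V on the plane of X and Y, the solution has
tr A = -1 and tr B = 0. *)
Lemma adapted_brk X (Y := J X) : adapted X ->
  exists p q m n,
  [/\ {[U, V]} = V,
      {[U, X]} = p *: X + q *: Y,
      {[U, Y]} = (- q - 2 * m) *: X - (1 + p) *: Y &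
  [/\ {[V, X]} = m *: X + n *: Y,
      {[V, Y]} = (1 + 2 * p - n) *: X - m *: Y &
      {[X, Y]} = 0] ].
Proof.
move=> aX; have T := adapted_table aX; have [XX UX VX] := aX.
have exp := adapted_expand aX.
have JY : J Y = - X by rewrite J2.
have trU := unimodular_expand aX U.
have trX := unimodular_expand aX X.
have trY := unimodular_expand aX Y.
have dO x y z := lck_domega lckL x y z.
have oUXY := dO U X Y; have oVXY := dO V X Y.
have oUVX := dO U V X; have oUVY := dO U V Y.
have VUX : g V {[U, X]} = 0 by rewrite integrableE ?T.
have VUY : g V {[U, Y]} = 0 by rewrite integrableE ?T.
have VXY : g V {[X, Y]} = 0 by rewrite integrableE ?T.
have nij x : g x {[V, Y]} - g x {[U, X]} + g (J x) {[V, X]} + g (J x) {[U, Y]} = 0.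
  have := lck_nijenhuis lckL U X; rewrite /nijenhuis => /(congr1 (g x)).
  by rewrite linear0r !linearBr /= -!met_cplx.
have nU := nij U; have nV := nij V; have nX := nij X; have nY := nij Y.
have altE : ({[V, U]} = - {[U, V]}) * ({[X, U]} = - {[U, X]}) *
  ({[Y, U]} = - {[U, Y]}) * ({[X, V]} = - {[V, X]}) *
  ({[Y, V]} = - {[V, Y]}) * ({[Y, X]} = - {[X, Y]}).
  by do !split; apply: brkC.
have brkC' z x y : g {[x, y]} z = g z {[x, y]} by exact: metC.
move: trU trX trY oUXY oVXY oUVX oUVY nU nV nX nY.
rewrite /ce2 /wedge12 /fundamental_form !leeE.
rewrite !altE !brkA !(J2, JY) !(linearNl, linearNr) /= !brkC' ?T ?lee_brk ?VUX ?VUY ?VXY.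
rewrite -/Y !linear0r => trU trX trY oUXY oVXY oUVX oUVY nU nV nX nY.
exists (g X {[U, X]}), (g Y {[U, X]}), (g X {[V, X]}), (g Y {[V, X]}).
have [[VUV XUV YUV] [XUY YUY] [VVX VVY XVY YVY] [XXY YXY]] :
  [/\ [/\ g V {[U, V]} = 1, g X {[U, V]} = 0 & g Y {[U, V]} = 0],
      g X {[U, Y]} = - g Y {[U, X]} - 2 * g X {[V, X]} /\
      g Y {[U, Y]} = - (1 + g X {[U, X]}),
      [/\ g V {[V, X]} = 0, g V {[V, Y]} = 0,
         g X {[V, Y]} = 1 + 2 * g X {[U, X]} - g Y {[V, X]} &
         g Y {[V, Y]} = - g X {[V, X]}] &
      g X {[X, Y]} = 0 /\ g Y {[X, Y]} = 0].
  move: trU trX trY oUXY oVXY oUVX oUVY nU nV nX nY; clear.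
  do !split; lra.
have comb x a b c : g U x = 0 -> g V x = a -> g X x = b -> g Y x = c ->
    x = a *: V + b *: X + c *: Y.
  by move=> Ux Vx Xx Yx; rewrite [LHS]exp Ux Vx Xx Yx scale0r add0r.
split; last split.
- rewrite [LHS](comb _ 1 0 0 (lee_brk _ _)) //; by rewrite !scale0r scale1r !addr0.
- by rewrite {1}(comb {[U, X]} 0 _ _ (lee_brk _ _) VUX erefl erefl) scale0r add0r.
- rewrite [LHS](comb _ 0 (- g Y {[U, X]} - 2 * g X {[V, X]})
    (- (1 + g X {[U, X]})) (lee_brk _ _)) //; by rewrite scale0r add0r scaleNr.
- by rewrite {1}(comb {[V, X]} 0 _ _ (lee_brk _ _) VVX erefl erefl) scale0r add0r.
- rewrite [LHS](comb _ 0 (1 + 2 * g X {[U, X]} - g Y {[V, X]})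
    (- g X {[V, X]}) (lee_brk _ _)) //; by rewrite scale0r add0r scaleNr.
- rewrite [LHS](comb _ 0 0 0 (lee_brk _ _)) //; by rewrite !scale0r !addr0.
Qed.

(** Entries of the matrix identity [A, B] = B, where the columns of A are (p, q)
and (r, s) and those of B are (m, n) and (o, - m); the fourth entry is the
opposite of the first, both sides being traceless. *)
Lemma adapted_jacobi X (Y := J X) (p q r s m n o : R) : adapted X ->
    {[U, V]} = V -> {[U, X]} = p *: X + q *: Y -> {[U, Y]} = r *: X + s *: Y ->
    {[V, X]} = m *: X + n *: Y -> {[V, Y]} = o *: X - m *: Y ->
  [/\ n * r - q * o = m, 2 * m * q + n * (s - p) = n &
      o * (p - s) - 2 * m * r = o].
Proof.
move=> aX UV UX UY VX VY; have T := adapted_table aX.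
have jac z x : g x ({[U, {[V, z]}]} + {[V, {[z, U]}]} + {[z, {[U, V]}]}) = 0.
  by rewrite (lck_lie lckL).2 linear0r.
have XX x y : {[x, y]} = - {[y, x]} by exact: brkC.
have jX := jac X X; have jY := jac X Y; have j'X := jac Y X.
move: jX jY j'X; rewrite UV VX VY (XX X U) (XX Y U) (XX X V) (XX Y V) UX UY VX VY.
rewrite !(brkDr, brkNr, brkZr) UX UY VX VY !(metDr, metNr, metZr) !T => e1 e2 e3.
clear -e1 e2 e3; split; lra.
Qed.

(** From [A, B] = B follows tr (B^2) = tr (B [A, B]) = 0, and B^2 is scalar
because B is traceless. *)
Lemma brk_nilpotent X : adapted X -> {[V, {[V, X]}]} = 0.
Proof.
move=> aX; have [p [q [m [n [UV UX UY [VX VY _]]]]]] := adapted_brk aX.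
rewrite -scaleNr in UY.
have [R1 R2 R3] := adapted_jacobi aX UV UX UY VX VY.
rewrite VX brkDr !brkZr VX VY scalerBr scalerDr !scalerA.
rewrite [n * m]mulrC addrACA subrr addr0 -scalerDl.
(* Weighted by the entries of B, the left sides of the Jacobi relations add up
   to tr (B [A, B]), which vanishes identically, and the right sides to
   tr (B^2). *)
have trB : 2 * (m * m + n * (1 + 2 * p - n)) = 0.
  have := congr1 ( *%R (2 * m)) R1; have := congr1 ( *%R n) R3.
  have := congr1 ( *%R (1 + 2 * p - n)) R2.
  lra.
rewrite (_ : _ + _ = 0) ?scale0r //; lra.
Qed.

(** Take any adapted X: since B^2 = 0, either B X = 0 or the normalization of B X
is an adapted vector killed by B. *)
Lemma exists_adapted_ker : exists2 X, adapted X & {[V, X]} = 0.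
Proof.
have unit_adapted X : X != 0 -> g U X = 0 -> g V X = 0 ->
    adapted ((Num.sqrt (g X X))^-1 *: X).
  rewrite -met_gt0 => X0 UX VX; split; rewrite ?metZl ?metZr ?UX ?VX ?mulr0 //.
  by rewrite mulrA -expr2 exprVn sqr_sqrtr ?ltW // mulVf // gt_eqF.
have [|Z Z0 [UZ VZ]] := exists_orthogonal U V; first by rewrite dim4.
have := unit_adapted Z Z0 UZ VZ; move: (_ *: Z) => X aX.
have [VX0|VX0] := eqVneq {[V, X]} 0; first by exists X.
exists ((Num.sqrt (g {[V, X]} {[V, X]}))^-1 *: {[V, X]}).
  apply: unit_adapted => //; first exact: lee_brk.
  have T := adapted_table aX.
  have [p [q [m [n [_ _ _ [-> _ _]]]]]] := adapted_brk aX.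
  by rewrite !(metDr, metZr) !T !mulr0 addr0.
by rewrite brkZr brk_nilpotent // scaler0.
Qed.

Lemma adapted_lck_iso X (c : nat -> nat -> 'rV[R]_4) : adapted X ->
    (forall i j : 'I_4, (i < j)%N ->
      {[adapted_frame X i, adapted_frame X j]} =
        c i j 0 0 *: U + c i j 0 1 *: V + c i j 0 2 *: X + c i j 0 3 *: J X) ->
  lck_iso L (model c).
Proof.
move=> aX brkE; apply: (frame_lck_iso (adapted_frame_on aX)) => //.
by move=> i j ij; rewrite brkE // big_ord4.
Qed.

Lemma uilck4_classification :
  (exists b : R, lck_iso L (lck_gb b)) \/ lck_iso L (@lck_d4 R).
Proof.
pose simp := (mulr1, mulr0, oppr0, addr0, add0r, subr0, scale0r, scale1r,
  scaleNr).
have [X aX VX0] := exists_adapted_ker.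
have [p [q [m [n [UV UX UY [VX VY XY]]]]]] := adapted_brk aX.
have T := adapted_table aX.
have m0 : m = 0.
  have := congr1 (g X) VX; rewrite VX0 linear0r !(metDr, metZr) !T; lra.
have n0 : n = 0.
  have := congr1 (g (J X)) VX; rewrite VX0 linear0r !(metDr, metZr) !T; lra.
have UY' := UY; rewrite -scaleNr in UY'.
have [R1 R2 R3] := adapted_jacobi aX UV UX UY' VX VY.
rewrite m0 n0 ?(mulr0, subr0, mul0r, scale0r) in UX UY VY R1 R2 R3.
(* This is the entry t of B (J X) = t X, subject to t^2 = t. *)
have [o0|o1] : 1 + 2 * p = 0 \/ 1 + 2 * p = 1.
  have : (1 + 2 * p) * (1 + 2 * p - 1) == 0 by apply/eqP; nra.
  by rewrite mulf_eq0 subr_eq0 => /orP[/eqP->|/eqP->]; [left|right].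
- have pE : p = - (1 / 2) by lra.
  have p1 : 1 + p = 1 / 2 by lra.
  rewrite o0 scale0r in VY; rewrite p1 in UY; rewrite pE in UX.
  left; exists q; apply: (adapted_lck_iso aX).
  by elim/ord4_ind; elim/ord4_ind => //= _;
    rewrite /adapted_frame /= ?UV ?UX ?UY ?VX0 ?VY ?XY !mxE /= !simp.
- have p0 : p = 0 by lra.
  have q0 : q = 0 by move: R1; rewrite o1; lra.
  rewrite o1 in VY; rewrite p0 q0 in UX UY.
  right; apply: (adapted_lck_iso aX).
  by elim/ord4_ind; elim/ord4_ind => //= _;
    rewrite /adapted_frame /= ?UV ?UX ?UY ?VX0 ?VY ?XY !mxE /= !simp.
Qed.

End Classification.

Theorem mainTheorem11 (R : realType) :
  [/\ (forall b : R, is_uilck4 (lck_gb b)),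
      is_uilck4 (@lck_d4 R),
      (forall L : lck_data R, is_uilck4 L ->
         (exists b : R, lck_iso L (lck_gb b)) \/ lck_iso L (@lck_d4 R)),
      (forall b b' : R, lck_iso (lck_gb b) (lck_gb b') -> b = b') &
      (forall b : R, ~ lck_iso (lck_gb b) (@lck_d4 R))].
Proof.
split.
- exact: gb_uilck4.
- exact: d4_uilck4.
- exact: uilck4_classification.
- exact: lck_iso_gb_inj.
- exact: not_lck_iso_gb_d4.
Qed.
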